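(* Let $n=pqrd$ where $p,q$ are two distinct primes and $r,d>1$ are integers. Then there exist $E,F\subseteq\mathbb{Z}_n$ which are not translates of each other but have the same $3$-deck.
   Context: For $f:\mathbb{Z}_n\to\mathbb{R}$, the $3$-deck is $N_{f,3}(x_1,x_2)=\sum_{x\in\mathbb{Z}_n} f(x)f(x+x_1)f(x+x_2)$ for $x_1,x_2\in\mathbb{Z}_n$; the $3$-deck of $E\subseteq\mathbb{Z}_n$ is that of its indicator function. $E$ and $F$ are translates of each other if $F=E+t$ for some $t\in\mathbb{Z}_n$. *)

(* Defs.v *)
From HB Require Import structures.
From mathcomp Require Import all_boot all_order all_algebra.
From mathcomp Require Import reals.

Set Implicit Arguments.
Unset Strict Implicit.
Unset Printing Implicit Defensive.

Import GRing.Theory.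
Local Open Scope ring_scope.

(* ['Z_n] is the ring of integers modulo [n] only for
   [1 < n]; the notions below are meant for such [n]. *)

Definition deck3 (R : realType) (n : nat) (f : 'Z_n -> R) (x1 x2 : 'Z_n) : R :=
  \sum_(x : 'Z_n) f x * f (x + x1) * f (x + x2).

Definition indicator (R : realType) (n : nat) (E : {set 'Z_n}) (x : 'Z_n) : R :=
  (x \in E)%:R.

Definition set_deck3 (R : realType) (n : nat) (E : {set 'Z_n}) :
    'Z_n -> 'Z_n -> R :=
  deck3 (indicator R E).

Definition translates (n : nat) (E F : {set 'Z_n}) : Prop :=
  exists t : 'Z_n, F = [set x + t | x in E].

(* Main.v *)
(* Put m = rd.  Let A be the set of multiples x of d with q | floor(x/m), and B
   the set of x = 1 mod d with p | floor(x/m).  Then A is invariant under the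
   subgroup H_p of order p and B under the subgroup H_q of order q, while A is
   equidistributed on the H_q-cosets contained in dZ_n and B on the H_p-cosets
   contained in 1 + dZ_n.  Compare E = A u B with F = A u (B - d).  In the
   3-deck, a mixed term with two factors from A pairs an H_p-periodic function
   with B; such a pairing depends only on the H_p-averages of B, which do not
   change when B is translated by d.  The terms with one factor from A are
   symmetric, and the two pure terms are unaffected, so E and F have the same
   3-deck.  If F = E + t with d | t, then A + t = A forces m | t while
   B + t = B - d forces m | t + d; otherwise A + t lies in B - d, which cannot
   hold for both of the points 0 and qm of A. *)

Require Import Defs.
From mathcomp Require Import all_boot all_order all_algebra.
From mathcomp Require Import reals.
From mathcomp Require Import zify ring.

Set Implicit Arguments.
Unset Strict Implicit.
Unset Printing Implicit Defensive.

Import GRing.Theory Num.Theory.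
Local Open Scope ring_scope.

(** * Correlation sums of periodic functions on a finite abelian group *)

Section PeriodicCorrelation.
Variables (R : numFieldType) (G : finZmodType).
Implicit Types (u v f g : G -> R) (h t : G).

Lemma sum_translate f t : \sum_x f (x + t) = \sum_x f x.
Proof. by rewrite [RHS](reindex_inj (addIr t)). Qed.

Lemma periodic_mulrn u h i x :
  (forall y, u (y + h) = u y) -> u (x + h *+ i) = u x.
Proof.
by move=> uh; elim: i => [|i IHi]; rewrite ?addr0 // mulrSr addrA uh.
Qed.

(** Shifting the summation variable by [h *+ i] fixes [u], so each of the [m] copies of the sum
    moves onto a translate of [v]. *)
Lemma sum_periodic_average u v h m : (forall x, u (x + h) = u x) ->
  m%:R * \sum_x u x * v x = \sum_x u x * \sum_(i < m) v (x + h *+ i).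
Proof.
move=> uh; under [RHS]eq_bigr do rewrite mulr_sumr.
rewrite exchange_big /= -[m in LHS]card_ord -sumr_const mulr_suml.
apply: eq_bigr => i _; rewrite mul1r -(sum_translate _ (h *+ i)).
by apply: eq_bigr => x _; rewrite periodic_mulrn.
Qed.

Lemma sum_periodic_translate u v h m t : (0 < m)%N ->
  (forall x, u (x + h) = u x) ->
  (forall x, \sum_(i < m) v (x + t + h *+ i) = \sum_(i < m) v (x + h *+ i)) ->
  \sum_x u x * v (x + t) = \sum_x u x * v x.
Proof.
move=> m_gt0 uh vt; have m_neq0 : m%:R != 0 :> R by rewrite pnatr_eq0 -lt0n.
apply: (mulfI m_neq0); rewrite !(sum_periodic_average _ _ uh).
apply: eq_bigr => x _; congr (_ * _); rewrite -vt.
by apply: eq_bigr => i _; rewrite addrAC.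
Qed.

Lemma sum_translate_periodic u v h m t : (0 < m)%N ->
  (forall x, u (x + h) = u x) ->
  (forall x, \sum_(i < m) v (x + t + h *+ i) = \sum_(i < m) v (x + h *+ i)) ->
  \sum_x u (x + t) * v x = \sum_x u x * v x.
Proof.
move=> m_gt0 uh vt; rewrite -[RHS](sum_translate _ t).
rewrite (@sum_periodic_translate (fun x => u (x + t)) v h m t m_gt0 _ vt) //.
by move=> x; rewrite addrAC uh.
Qed.

Lemma sum_triple_translate f g h k m l t : (0 < m)%N -> (0 < l)%N ->
  (forall x, f (x + h) = f x) -> (forall x, g (x + k) = g x) ->
  (forall x, \sum_(i < m) g (x + t + h *+ i) = \sum_(i < m) g (x + h *+ i)) ->
  (forall x, \sum_(i < l) f (x + t + k *+ i) = \sum_(i < l) f (x + k *+ i)) ->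
  forall y z,
  \sum_x (f x + g x) * (f (x + y) + g (x + y)) * (f (x + z) + g (x + z)) =
  \sum_x (f x + g (x + t)) * (f (x + y) + g (x + y + t)) *
         (f (x + z) + g (x + z + t)).
Proof.
move=> m_gt0 l_gt0 fh gk gt ft y z.
have two_f a b c : \sum_x f (x + a) * f (x + b) * g (x + c + t) =
                   \sum_x f (x + a) * f (x + b) * g (x + c).
  under eq_bigr do rewrite addrAC.
  apply: (@sum_periodic_translate (fun x => f (x + a) * f (x + b))
    (fun x => g (x + c)) h m t m_gt0) => x; first by rewrite !(addrAC _ h) !fh.
  under eq_bigr do rewrite addrAC (addrAC x).
  by rewrite gt; apply: eq_bigr => i _; rewrite addrAC.
have two_g a b c : \sum_x g (x + a + t) * g (x + b + t) * f (x + c) =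
                   \sum_x g (x + a) * g (x + b) * f (x + c).
  under eq_bigr do rewrite (addrAC _ a) (addrAC _ b).
  apply: (@sum_translate_periodic (fun x => g (x + a) * g (x + b))
    (fun x => f (x + c)) k l t l_gt0) => x; first by rewrite !(addrAC _ k) !gk.
  under eq_bigr do rewrite addrAC (addrAC x).
  by rewrite ft; apply: eq_bigr => i _; rewrite addrAC.
have three_g : \sum_x g (x + t) * g (x + y + t) * g (x + z + t) =
               \sum_x g x * g (x + y) * g (x + z).
  rewrite -[RHS](sum_translate _ t).
  by apply: eq_bigr => x _; rewrite !(addrAC _ t).
(* Writing [x + 0] gives all six mixed sums the shape of [two_f] or [two_g]. *)
have expand (g' : G -> R) :
  \sum_x (f x + g' x) * (f (x + y) + g' (x + y)) * (f (x + z) + g' (x + z)) =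
  \sum_x f x * f (x + y) * f (x + z) + \sum_x g' x * g' (x + y) * g' (x + z)
  + (\sum_x f (x + 0) * f (x + y) * g' (x + z)
     + \sum_x f (x + 0) * f (x + z) * g' (x + y)
     + \sum_x f (x + y) * f (x + z) * g' (x + 0))
  + (\sum_x g' (x + 0) * g' (x + y) * f (x + z)
     + \sum_x g' (x + 0) * g' (x + z) * f (x + y)
     + \sum_x g' (x + y) * g' (x + z) * f (x + 0)).
  by rewrite -!big_split; apply: eq_bigr => x _ /=; rewrite addr0; ring.
by rewrite expand (expand (fun x => g (x + t))) three_g !two_f !two_g.
Qed.

End PeriodicCorrelation.

(** * Slabs: a residue modulo [d] and a divisibility condition on the block index *)

Lemma sum_dvdn_progression (p q k : nat) : (0 < p)%N -> coprime p q ->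
  (\sum_(i < p) (p %| k + i * q) = 1)%N.
Proof.
move=> p_gt0 pq.
(* As [q] is invertible modulo [p], this map permutes the residues, so 0 is hit exactly once. *)
pose f (i : 'I_p) := Ordinal (ltn_pmod (k + i * q) p_gt0).
have f_inj : injective f.
  move=> i j [/eqP]; rewrite eqn_modDl => eij; apply: val_inj.
  wlog lij : i j eij / (j <= i)%N.
    case: (leqP j i) => [le H|/ltnW le H]; first exact: H.
    by apply/esym/H => //; rewrite eq_sym.
  move: eij; rewrite eqn_mod_dvd ?leq_mul2r ?lij ?orbT // -mulnBl Gauss_dvdl //.
  by rewrite -eqn_mod_dvd // !modn_small // => /eqP.
transitivity (\sum_(j < p) (p %| j))%N.
  rewrite [RHS](reindex_inj f_inj); apply: eq_bigr => i _.
  by rewrite /dvdn /= modn_mod.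
rewrite (bigD1 (Ordinal p_gt0)) //= dvdn0 big1 // => j j_neq0.
by rewrite gtnNdvd // lt0n.
Qed.

Definition slab (d m p c x : nat) : bool := (x %% d == c)%N && (p %| x %/ m)%N.

Section Slab.
Variables (d m p c : nat).
Hypotheses (m_gt0 : (0 < m)%N) (dm : (d %| m)%N).

Lemma slab_addM x k :
  slab d m p c (x + k * m) = (x %% d == c)%N && (p %| x %/ m + k)%N.
Proof.
rewrite /slab addnC divnMDl // (addnC k) -modnDml.
by rewrite (eqP (dvdn_mull k dm)).
Qed.

Lemma slab_period x k : (p %| k)%N -> slab d m p c (x + k * m) = slab d m p c x.
Proof. by move=> pk; rewrite slab_addM dvdn_addl. Qed.

Lemma slab_modn x n : (p * m %| n)%N -> slab d m p c (x %% n) = slab d m p c x.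
Proof.
move=> /dvdnP[k ->]; rewrite [in RHS](divn_eq x (k * (p * m))) addnC.
by rewrite !mulnA slab_period // dvdn_mull.
Qed.

(** A step of [q * m] keeps the residue modulo [d] and raises the block index by [q], so one of the
    [p] terms qualifies if the residue is [c]. The value depends only on [x %% d], hence a shift by
    [d] does not change it. *)
Lemma sum_slab (R : numFieldType) x q : (0 < p)%N -> coprime p q ->
  \sum_(i < p) (slab d m p c (x + i * (q * m)))%:R = (x %% d == c)%N%:R :> R.
Proof.
move=> p_gt0 pq; under eq_bigr do rewrite mulnA slab_addM -mulnb natrM.
rewrite -mulr_sumr -natr_sum sum_dvdn_progression //; exact: mulr1.
Qed.

End Slab.

Lemma natZp_add n (x : 'Z_n) k : (1 < n)%N ->
  (x + k%:R : 'Z_n) = ((x + k) %% n)%N :> nat.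
Proof. by move=> n_gt1; rewrite -{1}(natr_Zp x) -natrD val_Zp_nat. Qed.

(** * Rigidity: no shift carries the first union into the second *)

Local Open Scope nat_scope.

Lemma slab_union_rigid p q d m t :
  1 < p -> 1 < q -> coprime p q -> 1 < d -> d %| m -> 2 * d <= m ->
  ~ (forall k, slab d m q 0 k || slab d m p 1 k ->
               slab d m q 0 (k + t) || slab d m p 1 (k + t + d)).
Proof.
set A := slab d m q 0; set B := slab d m p 1.
move=> p_gt1 q_gt1 pq d_gt1 dm d2m step.
have m_gt0 : 0 < m by lia.
have lt_1d_m : 1 + d < m by lia.
have lt_1_m : 1 < m by lia.
have lt_1md_m : 1 + (m - d) < m by lia.
have shift_md a b : d <= b -> m - d + (a * m + b) = (a + 1) * m + (b - d).
  by rewrite mulnDl mul1n; lia.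
have shift_1md a : 1 + (m - d) + a * m + d = (a + 1) * m + 1.
  by rewrite mulnDl mul1n; lia.
have ndvd1 b a : 1 < b -> ~ (b %| a /\ b %| a + 1).
  move=> b_gt1 [ba]; rewrite dvdn_addr // dvdn1 => /eqP b1.
  by rewrite b1 in b_gt1.
have d_gt0 : 0 < d by exact: ltnW.
have mod0 : m - d = 0 %[mod d].
  by rewrite mod0n; apply/eqP; rewrite -/(dvdn _ _) dvdn_sub.
have md_m : (m - d) %/ m = 0 by apply: divn_small; rewrite ltn_subrL d_gt0.
have mod1d : 1 %% d = 1 by exact: modn_small.
have A0 : A 0 by rewrite /A /slab mod0n div0n dvdn0.
have Amd : A (m - d) by rewrite /A /slab mod0 mod0n md_m dvdn0.
have Aqm : A (q * m) by rewrite -[q * m]add0n /A slab_period.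
have B1 : B 1 by rewrite /B /slab mod1d divn_small ?dvdn0.
have B1md : B (1 + (m - d)).
  by rewrite /B /slab -modnDmr mod0 mod0n addn0 mod1d divn_small ?dvdn0.
have /orP[At|Bt] := step 0 (introT orP (or_introl A0)).
  rewrite add0n in At; have /andP[/eqP td qt] := At.
  have tA k : k = 0 %[mod d] -> A k -> A (k + t).
    move=> k0 Ak; have := step k (introT orP (or_introl Ak)).
    by rewrite /B /slab modnDr -modnDm td k0 mod0n /= mod0n orbF.
  have tB k : k = 1 %[mod d] -> B k -> B (k + t + d).
    move=> k1 Bk; have := step k (introT orP (or_intror Bk)).
    by rewrite {1}/A {1}/slab -modnDm td k1 mod1d addn0 mod1d.
  (* Otherwise [d <= t %% m], so adding [m - d] to [t] enters the next block, and [q] would divide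
     two consecutive block indices. *)
  have mt : t %% m = 0.
    apply/eqP/negPn/negP => tm_neq0; apply: (ndvd1 q (t %/ m) q_gt1).
    split => //.
    have d_tm : d <= t %% m.
      apply: dvdn_leq; first by rewrite lt0n.
      by apply/eqP; rewrite modn_dvdm // td.
    have /andP[_] := tA _ mod0 Amd.
    rewrite {1}(divn_eq t m) shift_md // divnMDl //.
    rewrite [(_ - _) %/ _]divn_small ?addn0 //.
    by rewrite (leq_ltn_trans (leq_subr _ _)) // ltn_mod.
  have tE : t = t %/ m * m by rewrite {1}(divn_eq t m) mt addn0.
  (* The points 1 and [1 + (m - d)] of [B] land in blocks [t %/ m] and [t %/ m + 1]. *)
  apply: (ndvd1 p (t %/ m) p_gt1); split.
    have /andP[_] := tB 1 (erefl _) B1.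
    by rewrite addnAC {1}tE addnC divnMDl // (divn_small lt_1d_m) addn0.
  have md1 : 1 + (m - d) = 1 %[mod d] by rewrite -modnDmr mod0 mod0n addn0.
  have /andP[_] := tB _ md1 B1md.
  by rewrite {1}tE shift_1md divnMDl // (divn_small lt_1_m) addn0.
(* Now [t] is 1 modulo [d], so [q * m] must also land in [B] after the shift by [t + d]; its block
   index exceeds that of [t + d] by [q], forcing [p] to divide [q]. *)
rewrite add0n in Bt.
have /andP[td1 pt] := Bt; rewrite modnDr in td1.
have := step _ (introT orP (or_introl Aqm)).
rewrite {1}/A {1}/slab -modnDml (eqP (dvdn_mull q dm)) add0n (eqP td1) /=.
rewrite -addnA addnC /B slab_addM // => /andP[_].
rewrite dvdn_addr // => /gcdn_idPl p_gcd.
by move: pq; rewrite /coprime p_gcd => /eqP p1; rewrite p1 in p_gt1.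
Qed.

Local Open Scope ring_scope.

(** * The two sets in ['Z_n] *)

Section Construction.
Variables (p q r d : nat).
Hypotheses (p_gt1 : (1 < p)%N) (q_gt1 : (1 < q)%N) (pq : coprime p q).
Hypotheses (r_gt1 : (1 < r)%N) (d_gt1 : (1 < d)%N).

Let m := (r * d)%N.
Let n := (p * q * r * d)%N.
Let A := slab d m q 0.
Let B := slab d m p 1.

Let m_gt0 : (0 < m)%N. Proof. by rewrite muln_gt0 (ltnW r_gt1) ltnW. Qed.
Let dm : (d %| m)%N. Proof. exact: dvdn_mull. Qed.
Let n_gt1 : (1 < n)%N.
Proof.
rewrite /n -2!mulnA (leq_trans p_gt1) // leq_pmulr //.
by rewrite !muln_gt0 (ltnW q_gt1) (ltnW r_gt1) ltnW.
Qed.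
Let qm_n : (q * m %| n)%N. Proof. by rewrite /n /m -!mulnA dvdn_mull. Qed.
Let pm_n : (p * m %| n)%N.
Proof. by rewrite /n /m (mulnC p q) -!mulnA dvdn_mull. Qed.

Definition union_set : {set 'Z_n} := [set x : 'Z_n | A x || B x].
(** The sum [x + d] is taken in [nat]; a wrap modulo [n] would not matter, since [p * m] divides
    [n]. *)
Definition shifted_union_set : {set 'Z_n} := [set x : 'Z_n | A x || B (x + d)].

Lemma union_set_deck3 (R : realType) (y z : 'Z_n) :
  set_deck3 R union_set y z = set_deck3 R shifted_union_set y z.
Proof.
pose f (x : 'Z_n) : R := (A x)%:R; pose g (x : 'Z_n) : R := (B x)%:R.
have fD x k : f (x + k%:R) = (A (x + k))%:R.
  by rewrite /f natZp_add // /A slab_modn.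
have gD x k : g (x + k%:R) = (B (x + k))%:R.
  by rewrite /g natZp_add // /B slab_modn.
have orE a b : ~~ (a && b) -> (a || b)%:R = a%:R + b%:R :> R.
  by case: a; case: b; rewrite ?addr0 ?add0r.
(* Both unions are disjoint: take [b] equal to [a] for the first, to [a + d] for the second. *)
have AB a b : a = b %[mod d] -> ~~ (A a && B b).
  by move=> ab; rewrite /A /B /slab ab; case: eqP => // ->; rewrite andbF.
have indE x : indicator R union_set x = f x + g x.
  by rewrite /indicator inE orE // AB.
have indF x : indicator R shifted_union_set x = f x + g (x + d%:R).
  by rewrite /indicator inE gD orE // AB // modnDr.
rewrite /set_deck3 /deck3.
under eq_bigr do rewrite !indE.
under [RHS]eq_bigr do rewrite !indF.
have sumf (x : 'Z_n) k : \sum_(i < q) f (x + k%:R + (p * m)%:R *+ i) =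
    ((x + k) %% d == 0)%N%:R.
  under eq_bigr do rewrite -mulrnA -addrA -natrD fD addnA (mulnC _ (_ : 'I_q)).
  by apply: sum_slab => //; [exact: ltnW|rewrite coprime_sym].
have sumg (x : 'Z_n) k : \sum_(i < p) g (x + k%:R + (q * m)%:R *+ i) =
    ((x + k) %% d == 1)%N%:R.
  under eq_bigr do rewrite -mulrnA -addrA -natrD gD addnA (mulnC _ (_ : 'I_p)).
  by apply: sum_slab => //; exact: ltnW.
apply: (@sum_triple_translate R 'Z_n f g (q * m)%:R (p * m)%:R p q d%:R).
- exact: ltnW.
- exact: ltnW.
- by move=> x; rewrite fD /A slab_period.
- by move=> x; rewrite gD /B slab_period.
- move=> x; have := sumg x 0%N; rewrite addr0 addn0 => e.
  by apply: etrans (sumg x d) _; rewrite modnDr; apply: esym.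
- move=> x; have := sumf x 0%N; rewrite addr0 addn0 => e.
  by apply: etrans (sumf x d) _; rewrite modnDr; apply: esym.
Qed.

Lemma union_set_not_translate : ~ translates union_set shifted_union_set.
Proof.
move=> [t Ft].
(* Membership is lifted to natural representatives, where slabs ignore reduction modulo [n]. *)
have step k : A k || B k -> A (k + t) || B (k + t + d).
  move=> kE; have : t + k%:R \in shifted_union_set.
    rewrite Ft addrC; apply: imset_f; rewrite inE val_Zp_nat //.
    by rewrite /A /B !slab_modn.
  rewrite inE natZp_add // (addnC k).
  by rewrite /A /B -(@slab_modn _ _ p _ _ _ (_ + d) n) // modnDml !slab_modn.
apply: (slab_union_rigid p_gt1 q_gt1 pq d_gt1 dm _ step).
by rewrite leq_mul2r r_gt1 orbT.
Qed.

End Construction.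

Theorem theorem3 (R : realType) (n p q r d : nat)
    (hp : prime p) (hq : prime q) (hpq : p <> q)
    (hr : (1 < r)%N) (hd : (1 < d)%N)
    (hn : n = (p * q * r * d)%N) :
  exists E F : {set 'Z_n},
    ~ translates E F /\
    (forall x1 x2 : 'Z_n, set_deck3 R E x1 x2 = set_deck3 R F x1 x2).
Proof.
have p_gt1 := prime_gt1 hp; have q_gt1 := prime_gt1 hq.
have pq : coprime p q by rewrite prime_coprime // dvdn_prime2 //; apply/eqP.
rewrite hn; exists (union_set p q r d), (shifted_union_set p q r d); split.
  exact: union_set_not_translate.
exact: union_set_deck3.
Qed.
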